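(* Let $N\in\mathbb N$, let $\mathbf s=\{s_i\}_{i=0}^{2n_N-2}$ be a regular sequence of real numbers with set of normal indices $\mathcal N(\mathbf s)=\{n_j\}_{j=1}^N$, let $m_j(z)$ $(1\le j\le N)$ and $l_j$ $(1\le j\le N-1)$ be the Schur parameters defined in the context, and let $$M_j(z)=\begin{pmatrix}1&0\\-zm_j(z)&1\end{pmatrix},\quad L_j=\begin{pmatrix}1&l_j\\0&1\end{pmatrix},\quad W_{2j-1}(z)=M_1(z)L_1\cdots L_{j-1}M_j(z).$$ Then the matrix $W_{2j-1}(z)$ admits the representation $$W_{2j-1}(z)=\begin{pmatrix}Q^+_{2j-1}(z)&Q^+_{2j-2}(z)\\P^+_{2j-1}(z)&P^+_{2j-2}(z)\end{pmatrix}\quad(j=1,\dots,N),$$ where the polynomials $P_j^+$ and $Q_j^+$ $(0\le j\le2N-1)$ are defined either by the recurrences (R) or by the determinantal formulas (D) given in the context.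
   Context: Matrices. $S_n=(s_{i+j})_{i,j=0}^{n-1}$, $S_n^+=(s_{i+j+1})_{i,j=0}^{n-1}$, $D_n=\det S_n$, $D_n^+=\det S_n^+$, $D_0^+=1$. $n\ge1$ is a normal index of $\mathbf s$ if $D_n\ne0$; $n_1<\dots<n_N$. The sequence $\mathbf s=\{s_i\}_{i=0}^{2n_N-2}$ is regular if $D^+_{n_j-1}\ne0$ for all $j=1,\dots,N$ (equivalently $D^+_{n_j}\ne0$ for $j=1,\dots,N-1$). Put $n_{-1}=-1$, $n_0=0$. (R): $P_{-1}^+\equiv0$, $P_0^+\equiv1$, $Q_{-1}^+\equiv1$, $Q_0^+\equiv0$, $P^+_{2i-1}=-zm_iP^+_{2i-2}+P^+_{2i-3}$, $Q^+_{2i-1}=-zm_iQ^+_{2i-2}+Q^+_{2i-3}$ $(1\le i\le N)$, $P^+_{2i}=l_iP^+_{2i-1}+P^+_{2i-2}$, $Q^+_{2i}=l_iQ^+_{2i-1}+Q^+_{2i-2}$ $(1\le i\le N-1)$. (D): $P^+_{-1}\equiv0$, $P_0^+\equiv1$, $Q^+_{-1}\equiv1$, $Q^+_0\equiv0$, $$P^+_{2i-1}(z)=\frac{-1}{b_0\cdots b_{i-1}}\begin{vmatrix}P_{n_i}(z)&P_{n_{i-1}}(z)\\P_{n_i}(0)&P_{n_{i-1}}(0)\end{vmatrix},\quad Q^+_{2i-1}(z)=\frac{1}{b_0\cdots b_{i-1}}\begin{vmatrix}Q_{n_i}(z)&Q_{n_{i-1}}(z)\\P_{n_i}(0)&P_{n_{i-1}}(0)\end{vmatrix}\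 (1\le i\le N),$$ $$P^+_{2i}(z)=\frac{P_{n_i}(z)}{P_{n_i}(0)},\quad Q^+_{2i}(z)=-\frac{Q_{n_i}(z)}{P_{n_i}(0)}\ (1\le i\le N-1).$$ Here $P_{-1}\equiv0$, $P_0\equiv1$, $Q_{-1}\equiv-1$, $Q_0\equiv0$, and for $1\le j\le N$ $$P_{n_j}(z)=\frac1{D_{n_j}}\det\begin{pmatrix}s_0&s_1&\cdots&s_{n_j}\\ \cdots&\cdots&\cdots&\cdots\\ s_{n_j-1}&s_{n_j}&\cdots&s_{2n_j-1}\\1&z&\cdots&z^{n_j}\end{pmatrix},\qquad Q_{n_j}(z)=\mathfrak S_t\left(\frac{P_{n_j}(z)-P_{n_j}(t)}{z-t}\right),$$ where $\mathfrak S_t$ is the linear functional with $\mathfrak S_t(t^i)=s_i$, and $s_{2n_N-1}$, needed for $P_{n_N}$, is an arbitrarily chosen real number (its choice does not affect $P^+_{2N-1}$, $Q^+_{2N-1}$). The numbers $b_j$: $b_0=s_{n_1-1}$, and for $1\le j\le N-1$, $b_j$ is the nonzero real number such that, with a monic polynomial $a_j$ of degree $n_{j+1}-n_j$, both $y=P$ and $y=Q$ satisfy $b_jy_{n_{j-1}}-a_j(z)y_{n_j}+y_{n_{j+1}}=0$. Toeplitz notation. $T(c_0,\dots,c_n)$ is the upper triangular $(n+1)\times(n+1)$ matrix with entries $c_{j-i}$ for $i\le j$ and $0$ for $i>j$. Schur parameters (with $\ell=2n_N-2$). Put $\mathbf s^{(0)}=\mathbf s$. Given $\mathbf s^{(j-1)}=\{s_i^{(j-1)}\}_{i=0}^{\ell-2n_{j-1}}$,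 let $\nu=n_j-n_{j-1}$ (then $s^{(j-1)}_0=\dots=s^{(j-1)}_{\nu-2}=0$, $s^{(j-1)}_{\nu-1}\ne0$), $D_\nu^{(j-1)}=\det(s^{(j-1)}_{i+p})_{i,p=0}^{\nu-1}$, $(D_\nu^{(j-1)})^+=\det(s^{(j-1)}_{i+p+1})_{i,p=0}^{\nu-1}$. Then $m_j(z)=\frac{(-1)^{\nu+1}}{D_\nu^{(j-1)}}\Delta_j(z)=\sum_{i=0}^{\nu-1}m_i^{(j)}z^i$ for $1\le j\le N$, where $\Delta_j(z)$ is the determinant of the $\nu\times\nu$ matrix whose first $\nu-1$ rows are $(s^{(j-1)}_{i+1},\dots,s^{(j-1)}_{i+\nu})$, $i=0,\dots,\nu-2$, and whose last row is $(1,z,\dots,z^{\nu-1})$; and $l_j=(-1)^{\nu+1}s^{(j-1)}_{\nu-1}D_\nu^{(j-1)}/(D_\nu^{(j-1)})^+$ for $1\le j\le N-1$. For $1\le j\le N-1$ the sequences $\{\mathfrak s_i^{(j)}\}_{i=-1}^{\ell-2n_j}$ and $\mathbf s^{(j)}=\{s_i^{(j)}\}_{i=0}^{\ell-2n_j}$ are determined by $$T(m^{(j)}_{\nu-1},\dots,m^{(j)}_0,-\mathfrak s^{(j)}_{-1},\dots,-\mathfrak s^{(j)}_{\ell-2n_j})\,T(s^{(j-1)}_{\nu-1},\dots,s^{(j-1)}_{\ell-2n_{j-1}})=I,$$ $$T(l_j,-s_0^{(j)},\dots,-s^{(j)}_{\ell-2n_j})\,T(\mathfrak s^{(j)}_{-1},\dots,\mathfrak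 s^{(j)}_{\ell-2n_j})=I .$$ *)

(* Defs.v *)
From HB Require Import structures.
From mathcomp Require Import all_boot all_order all_algebra.
From mathcomp Require Import reals.

Set Implicit Arguments.
Unset Strict Implicit.
Unset Printing Implicit Defensive.

Import Order.TTheory GRing.Theory Num.Theory.
Local Open Scope ring_scope.

(* A finite sequence (s_0, ..., s_l) is an element of [seq R] of size l + 1.
   Reading past the end gives the default 0; every definition below is only
   used at indices where the entries it reads exist. *)

Section Sequences.
Variable R : realType.
Implicit Types (s t c : seq R) (n k j : nat).

Definition hankel s n : 'M[R]_n := \matrix_(i, p) s`_(i + p).
Definition hankel_plus s n : 'M[R]_n := \matrix_(i, p) s`_(i + p + 1).

(* The determinant of a 0 x 0 matrix is 1, so D_0 = D_0^+ = 1. *)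
Definition D s n : R := \det (hankel s n).
Definition D_plus s n : R := \det (hankel_plus s n).

(* D_n reads s_0, ..., s_(2n-2), so it makes sense iff 2n - 1 <= size s, i.e.
   iff n <= uphalf (size s). *)
Definition normal_indices s : seq nat :=
  [seq n <- iota 1 (uphalf (size s)) | D s n != 0].

(* n_j, including n_0 = 0 *)
Definition nidx s j : nat := nth 0%N (0%N :: normal_indices s) j.

Definition regular s : Prop :=
  forall j, (1 <= j <= size (normal_indices s))%N ->
    D_plus s (nidx s j - 1) != 0.

(* T(c_0, ..., c_n); to be used with k = size c = n + 1 *)
Definition toeplitz k c : 'M[R]_k :=
  \matrix_(i, j) if (i <= j)%N then c`_(j - i) else 0.

(* Schur parameters: t is s^(j-1) and nu = n_j - n_(j-1). *)

Definition Delta t nu : {poly R} :=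
  \det (\matrix_(i < nu, p < nu)
          if (i.+1 < nu)%N then (t`_(i + p + 1))%:P else 'X^p).

Definition schur_m t nu : {poly R} :=
  ((-1) ^+ nu.+1 / D t nu) *: Delta t nu.

Definition schur_l t nu : R :=
  (-1) ^+ nu.+1 * t`_(nu - 1) * D t nu / D_plus t nu.

(* ss j is s^(j), and fs j is the sequence (fraktur s)^(j), whose indices
   start at -1: its i-th entry is (fraktur s)^(j)_(i-1).  The parameters
   m_j, l_j are computed from s^(j-1) = ss j.-1. *)

Definition gap s j : nat := (nidx s j - nidx s j.-1)%N.
Definition mpar s (ss : nat -> seq R) j : {poly R} := schur_m (ss j.-1) (gap s j).
Definition lpar s (ss : nat -> seq R) j : R := schur_l (ss j.-1) (gap s j).

Definition schur_step s (ss fs : nat -> seq R) j : Prop :=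
  let nu := gap s j in
  let m_coefs := rev (mkseq (fun i => (mpar s ss j)`_i) nu) in
  (* with l = size s - 1: s^(j) has indices 0, ..., l - 2 n_j *)
  [/\ size (ss j) = (size s - 2 * nidx s j)%N,
      size (fs j) = (size (ss j)).+1,
      let k := (nu + size (fs j))%N in
      toeplitz k (m_coefs ++ map -%R (fs j))
        *m toeplitz k (drop (nu - 1) (ss j.-1)) = 1%:M
    & let k := size (fs j) in
      toeplitz k (lpar s ss j :: map -%R (ss j)) *m toeplitz k (fs j) = 1%:M].

Definition schur_sequences s (ss fs : nat -> seq R) : Prop :=
  ss 0%N = s /\
  forall j, (1 <= j < size (normal_indices s))%N -> schur_step s ss fs j.

(* Orthogonal polynomials.  Bivariate polynomials in z and t are elements of
   {poly {poly R}}: the outer variable is t, the inner one is z. *)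

Definition moment_t s (p : {poly {poly R}}) : {poly R} :=
  \sum_(i < size p) s`_i *: p`_i.

(* For k = 0 this is the constant 1, in accordance with P_0 = 1. *)
Definition Ppol s k : {poly R} :=
  (D s k)^-1 *: \det (\matrix_(i < k.+1, p < k.+1)
                        if (i < k)%N then (s`_(i + p))%:P else 'X^p).

(* The quotient (P(z) - P(t)) / (z - t), an exact division; Q_0 = 0. *)
Definition Qpol s k : {poly R} :=
  let P := Ppol s k in
  moment_t s ((P%:P - map_poly polyC P) %/ ('X%:P - 'X)).

End Sequences.

Section Plus.
Variable R : realType.
Implicit Types (s : seq R) (P Q : int -> {poly R}).

Definition mx2 (A : Type) (a b c d : A) : 'M[A]_2 :=
  \matrix_(i, j) if i == 0 then (if j == 0 then a else b)
                 else (if j == 0 then c else d).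

Definition plus_init P Q : Prop :=
  [/\ P (-1) = 0, P 0 = 1, Q (-1) = 1 & Q 0 = 0].

Definition plus_by_recurrence (N : nat) (m : nat -> {poly R}) (l : nat -> R)
    P Q : Prop :=
  [/\ plus_init P Q,
      forall i : nat, (1 <= i <= N)%N ->
        P (2 * i%:Z - 1) = - 'X * m i * P (2 * i%:Z - 2) + P (2 * i%:Z - 3) /\
        Q (2 * i%:Z - 1) = - 'X * m i * Q (2 * i%:Z - 2) + Q (2 * i%:Z - 3)
    & forall i : nat, (1 <= i <= N - 1)%N ->
        P (2 * i%:Z) = l i *: P (2 * i%:Z - 1) + P (2 * i%:Z - 2) /\
        Q (2 * i%:Z) = l i *: Q (2 * i%:Z - 1) + Q (2 * i%:Z - 2)].

(* In the next two definitions c is the arbitrary value of s_(2 n_N - 1). *)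

Definition three_term s (c : R) (b : nat -> R) : Prop :=
  let Pn j := Ppol (rcons s c) (nidx s j) in
  let Qn j := Qpol (rcons s c) (nidx s j) in
  b 0%N = s`_(nidx s 1 - 1) /\
  forall j, (1 <= j < size (normal_indices s))%N ->
    b j != 0 /\
    exists a : {poly R},
      [/\ a \is monic,
          size a = (nidx s j.+1 - nidx s j).+1,
          b j *: Pn j.-1 - a * Pn j + Pn j.+1 = 0
        & b j *: Qn j.-1 - a * Qn j + Qn j.+1 = 0].

Definition plus_by_determinants (N : nat) s (c : R) (b : nat -> R) P Q : Prop :=
  let Pn j := Ppol (rcons s c) (nidx s j) in
  let Qn j := Qpol (rcons s c) (nidx s j) in
  let Pn0 j : {poly R} := ((Pn j).[0])%:P in
  [/\ plus_init P Q,
      forall i : nat, (1 <= i <= N)%N ->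
        P (2 * i%:Z - 1) = (-1 / \prod_(k < i) b k)
            *: \det (mx2 (Pn i) (Pn i.-1) (Pn0 i) (Pn0 i.-1)) /\
        Q (2 * i%:Z - 1) = (1 / \prod_(k < i) b k)
            *: \det (mx2 (Qn i) (Qn i.-1) (Pn0 i) (Pn0 i.-1))
    & forall i : nat, (1 <= i <= N - 1)%N ->
        P (2 * i%:Z) = ((Pn i).[0])^-1 *: Pn i /\
        Q (2 * i%:Z) = - (((Pn i).[0])^-1 *: Qn i)].

Definition Mmat (m : {poly R}) : 'M[{poly R}]_2 := mx2 1 0 (- 'X * m) 1.
Definition Lmat (l : R) : 'M[{poly R}]_2 := mx2 1 l%:P 0 1.

(* Wodd m l j is W_(2j-1) = M_1 L_1 M_2 L_2 ... L_(j-1) M_j, for j >= 1. *)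
Definition Wodd (m : nat -> {poly R}) (l : nat -> R) (j : nat)
    : 'M[{poly R}]_2 :=
  (\prod_(1 <= i < j) (Mmat (m i) * Lmat (l i))) * Mmat (m j).

End Plus.

(* Main.v *)
Require Import Defs.
From HB Require Import structures.
From mathcomp Require Import all_boot all_order all_algebra.
From mathcomp Require Import reals.
From mathcomp Require Import ring zify.

Set Implicit Arguments.
Unset Strict Implicit.
Unset Printing Implicit Defensive.

Import GRing.Theory.
Local Open Scope ring_scope.

(** Why the representation holds.

    If the pairs (P^+, Q^+) obey the recurrences (R), then passing from
    W_(2j-1) to W_(2j+1) = W_(2j-1) L_j M_(j+1) performs two steps of the
    recurrence on the rows of W_(2j-1), so the formula is an induction on j
    ([Wodd_recurrence]).  The substance is that the determinantal formulas (D)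
    satisfy these recurrences with exactly the Schur parameters m_j and l_j.

    Let A_(2j-1), A_(2j) be the polynomials produced by the P-half of (R) from
    the Schur parameters ([denominators]).  Write the moments as the series
    f_0 = - sum_i s_i / z^(i+1) and f_j likewise for s^(j).  The two Toeplitz
    equations say 1 / f_j = - z m_(j+1) + 1 / (l_(j+1) + f_(j+1)) up to
    truncation.  Consequently the remainders R_k = A_k f_0 - B_k, with B_k
    polynomial, satisfy R_(2j) = - f_j R_(2j-1), where R_(2j-1) has order
    exactly n_j at infinity ([odd_expansion_step], [even_expansion_step]).
    Negative powers are handled by reversing polynomials ([mirror]), so that
    all of this becomes an identity of polynomials in w = 1/z modulo a power
    of w.

    Reading off coefficients of the remainders gives orthogonality: A_(2j) is
    orthogonal to z^k for k < n_(j+1) - 1 and not for k = n_(j+1) - 1, and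
    A_(2j+1) is orthogonal to z^k for k < n_(j+1) - 1.  This needs the first
    nonzero entry of s^(j) to have index n_(j+1) - n_j - 1.  That holds since
    the first index at which A_(2j) stops being orthogonal produces a normal
    index ([hankel_neq0_next]), while no normal index lies strictly between
    n_j and n_(j+1).  Orthogonality together with A_(2j)(0) = 1 forces
    A_(2j) = P_(n_j) / P_(n_j)(0), and in particular P_(n_j)(0) <> 0.

    On the other side, the three-term relation b_j y_(n_(j-1)) - a_j y_(n_j) +
    y_(n_(j+1)) = 0 shows that the polynomials of (D) obey the odd recurrences
    with some Y_j in place of z m_(j+1), namely a multiple of a_j - a_j(0), or
    of P_(n_1) - P_(n_1)(0) when j = 0 ([determinant_quotient]).  The
    difference (Y_j - z m_(j+1)) A_(2j) is then orthogonal to z^k for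
    k < n_(j+1) - 1.  If Y_j - z m_(j+1) were nonzero of degree d >= 1, pairing
    with z^(n_(j+1) - 1 - d) would contradict the nonorthogonality of A_(2j)
    ([multiple_orthogonal_eq0]); hence Y_j = z m_(j+1).  For j = 0 the case
    d = n_1 is excluded beforehand by comparing leading coefficients.  The
    parameters l_j are then determined by the even recurrence for P^+.  The
    relations for Q^+ involve the same Y_j and the same scalars, so the Q-half
    of (R) follows. *)

(** * Moments, orthogonality and Hankel determinants *)

Lemma poly_sum_widen (R : nzRingType) (n : nat) (p : {poly R}) :
  (size p <= n)%N -> p = \sum_(i < n) p`_i *: 'X^i.
Proof.
move=> le_pn; rewrite -poly_def; apply/polyP => i; rewrite coef_poly.
by case: ltnP => // le_ni; rewrite nth_default // (leq_trans le_pn).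
Qed.

(** The functional S_t of the orthogonal polynomials, t^i |-> s_i, extended by
    zero to the powers beyond the end of [s]. *)
Definition moment (R : realType) (s : seq R) (G : {poly R}) : R :=
  \sum_(i < size s) G`_i * s`_i.

Fact moment_is_linear (R : realType) (s : seq R) : scalar (moment s).
Proof.
move=> a p q; rewrite /moment mulr_sumr -big_split /=; apply: eq_bigr => i _.
by rewrite coefD coefZ mulrDl mulrA.
Qed.

HB.instance Definition _ (R : realType) (s : seq R) :=
  GRing.isLinear.Build R {poly R} R *%R (moment s) (moment_is_linear s).

Lemma moment_Xn (R : realType) (s : seq R) (k : nat) : moment s 'X^k = s`_k.
Proof.
rewrite /moment; case: (ltnP k (size s)) => [lt_ks|le_sk]; last first.
  rewrite nth_default // big1 // => i _; rewrite coefXn.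
  by rewrite (negPf (negbT (ltn_eqF (leq_trans (ltn_ord i) le_sk)))) mul0r.
rewrite (bigD1 (Ordinal lt_ks)) //= coefXn eqxx mul1r big1 ?addr0 // => i.
by rewrite coefXn -val_eqE /= => /negPf ->; rewrite mul0r.
Qed.

Lemma moment_mulXn (R : realType) (s : seq R) (n k : nat) (G : {poly R}) :
  (size G <= n)%N -> moment s (G * 'X^k) = \sum_(i < n) G`_i * s`_(i + k).
Proof.
move=> le_Gn; rewrite {1}(poly_sum_widen le_Gn) mulr_suml linear_sum /=.
by apply: eq_bigr => i _; rewrite -scalerAl -exprD linearZ /= moment_Xn.
Qed.

Definition orthogonal (R : realType) (s : seq R) (G : {poly R}) (e : nat) :=
  forall k, (k < e)%N -> moment s (G * 'X^k) = 0.

(** Only the top monomial of K can contribute. *)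
Lemma orthogonal_top (R : realType) (s : seq R) (A K : {poly R}) (e : nat) :
  orthogonal s A e -> (size K <= e.+1)%N ->
  moment s (A * K) = K`_e * moment s (A * 'X^e).
Proof.
move=> oA le_Ke; rewrite {1}(poly_sum_widen le_Ke) big_ord_recr /= mulrDr.
rewrite mulr_sumr linearD linear_sum /= big1 ?add0r => [|i _].
  by rewrite -scalerAr linearZ.
by rewrite -scalerAr linearZ /= oA // mulr0.
Qed.

Lemma orthogonal_lt (R : realType) (s : seq R) (A K : {poly R}) (e : nat) :
  orthogonal s A e -> (size K <= e)%N -> moment s (A * K) = 0.
Proof.
move=> oA le_Ke; rewrite (orthogonal_top oA (leqW le_Ke)).
by rewrite nth_default // mul0r.
Qed.

(** The moments of G z^k are the entries of the coefficient vector of G times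
    the Hankel matrix, so G is a kernel vector. *)
Lemma hankel_neq0_orthogonal (R : realType) (s : seq R) (n : nat)
    (G : {poly R}) :
  D s n != 0 -> (size G <= n)%N -> orthogonal s G n -> G = 0.
Proof.
move=> Dn le_Gn oG; apply/eqP; apply: contraNT Dn => G_neq0.
apply/det0P; exists (poly_rV G).
  apply: contra_neq G_neq0 => G0.
  by rewrite -(poly_rV_K le_Gn) G0 linear0.
apply/rowP => p; rewrite !mxE.
transitivity (moment s (G * 'X^p)); last exact: oG.
by rewrite (moment_mulXn _ _ le_Gn); apply: eq_bigr => i _; rewrite !mxE.
Qed.

Lemma hankel_eq0_orthogonal (R : realType) (s : seq R) (n : nat) :
  D s n = 0 ->
  exists G : {poly R}, [/\ G != 0, (size G <= n)%N & orthogonal s G n].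
Proof.
move=> /eqP/det0P [v v_neq0 vS]; exists (rVpoly v); split.
- by apply: contra_neq v_neq0 => v0; rewrite -(rVpolyK v) v0 linear0.
- exact: size_poly.
move=> k lt_kn; rewrite (moment_mulXn _ _ (size_poly _ _)).
have := congr1 (fun w : 'rV_n => w 0 (Ordinal lt_kn)) vS; rewrite !mxE.
by apply: etrans; apply: eq_bigr => i _; rewrite coef_rVpoly_ord !mxE.
Qed.

Lemma coef_top_neq0 (R : nzRingType) (p : {poly R}) (e : nat) :
  size p = e.+1 -> p`_e != 0.
Proof.
move=> size_p; have -> : e = (size p).-1 by rewrite size_p.
by rewrite -lead_coefE lead_coef_eq0 -size_poly_eq0 size_p.
Qed.

(** The first power to which A fails to be orthogonal marks a nonsingular
    Hankel matrix: a kernel vector G of that matrix has degree at least n since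
    D_n <> 0, and multiplying it by a power of z brings its degree to n + mu, so
    that it detects the nonzero moment of A z^(n + mu) although it annihilates
    every polynomial of degree at most n + mu. *)
Lemma hankel_neq0_next (R : realType) (s : seq R) (n mu : nat) (A : {poly R}) :
  D s n != 0 -> size A = n.+1 -> orthogonal s A (n + mu) ->
  moment s (A * 'X^(n + mu)) != 0 -> D s (n + mu).+1 != 0.
Proof.
move=> Dn size_A oA; apply: contra_neq => /hankel_eq0_orthogonal.
case=> G [G_neq0 le_G oG].
have A_neq0 : A != 0 by rewrite -size_poly_gt0 size_A.
have [le_Gn|lt_nG] := leqP (size G) n.
  suff G0 : G = 0 by rewrite G0 eqxx in G_neq0.
  by apply: (hankel_neq0_orthogonal Dn le_Gn) => k lt_kn; apply: oG; lia.
pose e := ((n + mu).+1 - size G)%N.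
have size_K : size (G * 'X^e) = (n + mu).+1.
  by rewrite size_mulXn // /e; lia.
have lead_K := coef_top_neq0 size_K.
(* The same moment, computed with G as the annihilator and then with A. *)
have K0 : moment s (A * (G * 'X^e)) = 0.
  rewrite [A * _](_ : _ = G * (A * 'X^e)); last by ring.
  by apply: (orthogonal_lt oG); rewrite size_mulXn // size_A /e; lia.
move: K0; rewrite (orthogonal_top oA) ?size_K // => /eqP.
by rewrite mulf_eq0 (negPf lead_K) /= => /eqP.
Qed.

(** * Determinants with a row of monomials *)

(** The common shape of the determinants defining [Ppol] and [Delta]: scalar
    rows above one row [v] that may consist of monomials.  The top entries are
    transported by [f] so that the same determinant can be taken over R and
    over polynomials. *)
Definition last_row_det (R : realType) (n : nat) (c : nat -> nat -> R)
    (A : comNzRingType) (f : R -> A) (v : nat -> A) : A :=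
  \det (\matrix_(i < n.+1, p < n.+1) if (i < n)%N then f (c i p) else v p).

Lemma last_row_det_cofactor (R : realType) (n : nat) (c : nat -> nat -> R)
    (A : comNzRingType) (f : {rmorphism R -> A}) (v : nat -> A) :
  last_row_det n c f v = \sum_(p < n.+1) v p *
    f (cofactor (\matrix_(i < n.+1, q < n.+1)
         if (i < n)%N then c i q else 0) ord_max p).
Proof.
rewrite /last_row_det (expand_det_row _ ord_max); apply: eq_bigr => p _.
rewrite mxE ltnn -cofactor_map_mx; congr (_ * (_ * \det _)).
apply/matrixP => i q; rewrite !mxE /=.
have -> : (bump n i < n)%N by rewrite /bump (leqNgt n) ltn_ord add0n ltn_ord.
by [].
Qed.

Lemma coef_last_row_det (R : realType) (n p : nat) (c : nat -> nat -> R) :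
  (last_row_det n c polyC (fun q => 'X^q))`_p =
  if (p <= n)%N then last_row_det n c idfun (fun q => (q == p)%:R) else 0.
Proof.
rewrite (last_row_det_cofactor _ _ polyC) (last_row_det_cofactor _ _ idfun).
rewrite coef_sum; under eq_bigr => q _ do
  rewrite mulrC mul_polyC coefZ coefXn mulrC eq_sym.
case: ifP => // gt_pn; apply: big1 => q _.
by case: eqP => [qp|_]; rewrite ?mul0r //; have := ltn_ord q; lia.
Qed.

Lemma size_last_row_det (R : realType) (n : nat) (c : nat -> nat -> R) :
  (size (last_row_det n c polyC (fun q => 'X^q)) <= n.+1)%N.
Proof.
by apply/leq_sizeP => p le_np; rewrite coef_last_row_det leqNgt le_np.
Qed.

(** Pairing the coefficients with numbers v_p replaces the monomials of the
    last row by these numbers; orthogonality and normalization are both read off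
    from this. *)
Lemma sum_coef_last_row_det (R : realType) (n : nat) (c : nat -> nat -> R)
    (v : nat -> R) :
  \sum_(p < n.+1) (last_row_det n c polyC (fun q => 'X^q))`_p * v p =
  last_row_det n c idfun v.
Proof.
rewrite (last_row_det_cofactor _ _ idfun); apply: eq_bigr => p _.
rewrite coef_last_row_det -ltnS ltn_ord (last_row_det_cofactor _ _ idfun).
rewrite [X in X * _](bigD1 p) //= eqxx mul1r big1 => [|q].
  by rewrite addr0 mulrC.
by rewrite -val_eqE /= => /negPf ->; rewrite mul0r.
Qed.

Lemma last_row_det_repeat (R : realType) (n i : nat) (c : nat -> nat -> R)
    (v : nat -> R) :
  (i < n)%N -> (forall p, v p = c i p) -> last_row_det n c idfun v = 0.
Proof.
move=> lt_in vE.
apply: (@determinant_alternate _ _ _ (Ordinal (leqW lt_in)) ord_max).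
  by rewrite -val_eqE /= ltn_eqF.
by move=> p; rewrite !mxE /= lt_in ltnn vE.
Qed.

Lemma last_row_det_delta (R : realType) (n : nat) (c : nat -> nat -> R) :
  last_row_det n c idfun (fun q => (q == n)%:R) =
  \det (\matrix_(i < n, p < n) c i p).
Proof.
rewrite (last_row_det_cofactor _ _ idfun) (bigD1 ord_max) //= eqxx mul1r.
rewrite big1 ?addr0 => [|q]; last first.
  by rewrite -val_eqE /= => /negPf ->; rewrite mul0r.
rewrite /cofactor /= addnn -mul2n exprM sqrrN !expr1n mul1r; congr (\det _).
have bumpE (i : 'I_n) : bump n i = i by rewrite /bump (leqNgt n) ltn_ord.
by apply/matrixP => i p; rewrite !mxE /= !bumpE ltn_ord.
Qed.

(** * The orthogonal polynomials and the Schur parameter m *)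

Lemma hankel0 (R : realType) (s : seq R) : D s 0 = 1.
Proof. exact: det_mx00. Qed.

Lemma Ppol_lastE (R : realType) (s : seq R) (k : nat) :
  Ppol s k = (D s k)^-1 *:
    last_row_det k (fun i p => s`_(i + p)) polyC (fun q => 'X^q).
Proof. by []. Qed.

Lemma size_Ppol_le (R : realType) (s : seq R) (k : nat) :
  (size (Ppol s k) <= k.+1)%N.
Proof.
rewrite Ppol_lastE.
exact: leq_trans (size_scale_leq _ _) (size_last_row_det _ _).
Qed.

Lemma coef_Ppol_top (R : realType) (s : seq R) (k : nat) :
  D s k != 0 -> (Ppol s k)`_k = 1.
Proof.
move=> Dk; rewrite Ppol_lastE coefZ coef_last_row_det leqnn last_row_det_delta.
exact: mulVf.
Qed.

Lemma size_Ppol (R : realType) (s : seq R) (k : nat) :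
  D s k != 0 -> size (Ppol s k) = k.+1.
Proof.
move=> Dk; apply/eqP; rewrite eqn_leq size_Ppol_le /= ltnNge.
apply/negP => le_k; have /eqP := coef_Ppol_top Dk.
by rewrite nth_default // eq_sym oner_eq0.
Qed.

Lemma orthogonal_Ppol (R : realType) (s : seq R) (k : nat) :
  orthogonal s (Ppol s k) k.
Proof.
move=> i lt_ik; rewrite Ppol_lastE -scalerAl linearZ /=.
rewrite (moment_mulXn _ _ (size_last_row_det _ _)).
rewrite (sum_coef_last_row_det _ _ (fun p => s`_(p + i))).
by rewrite (@last_row_det_repeat _ _ i) ?mulr0 // => p; rewrite addnC.
Qed.

Lemma Ppol0 (R : realType) (s : seq R) : Ppol s 0 = 1.
Proof.
have D0 : D s 0 != 0 by rewrite hankel0 oner_eq0.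
by rewrite (size1_polyC (size_Ppol_le s 0)) coef_Ppol_top.
Qed.

Lemma hankel_antitriangular (R : realType) (t : seq R) (n : nat) :
  (forall i, (i < n)%N -> t`_i = 0) -> t`_n != 0 -> D t n.+1 != 0.
Proof.
move=> t0 tn; apply: (@hankel_neq0_next _ _ 0 n 1).
- by rewrite hankel0 oner_eq0.
- by rewrite size_poly1.
- by move=> i lt_in; rewrite mul1r moment_Xn t0.
- by rewrite mul1r moment_Xn.
Qed.

Lemma schur_m_lastE (R : realType) (t : seq R) (n : nat) :
  schur_m t n.+1 = ((-1) ^+ n.+2 / D t n.+1) *:
    last_row_det n (fun i p => t`_(i + p + 1)) polyC (fun q => 'X^q).
Proof. by []. Qed.

Lemma size_schur_m (R : realType) (t : seq R) (n : nat) :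
  (size (schur_m t n.+1) <= n.+1)%N.
Proof.
rewrite schur_m_lastE.
exact: leq_trans (size_scale_leq _ _) (size_last_row_det _ _).
Qed.

(** For i > 0 the last row of the determinant repeats an earlier one; for
    i = 0 the rows are those of the Hankel matrix of t, cyclically permuted,
    which accounts for the sign in [schur_m]. *)
Lemma schur_m_moment (R : realType) (t : seq R) (n i : nat) :
  (forall i, (i < n)%N -> t`_i = 0) -> t`_n != 0 -> (i <= n)%N ->
  moment t (schur_m t n.+1 * 'X^i) = (i == 0)%:R.
Proof.
move=> t0 tn le_in; have Dn := hankel_antitriangular t0 tn.
rewrite schur_m_lastE -scalerAl linearZ /=.
rewrite (moment_mulXn _ _ (size_last_row_det _ _)).
rewrite (sum_coef_last_row_det _ _ (fun p => t`_(p + i))).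
case: i le_in => [|i] le_in; last first.
  rewrite (@last_row_det_repeat _ _ i) ?mulr0 // => p.
  by rewrite addn1 addnS addnC.
have -> : last_row_det n (fun i p => t`_(i + p + 1)) idfun (fun p => t`_(p + 0))
    = (-1) ^+ n * D t n.+1.
  rewrite /last_row_det /D (expand_det_row _ ord_max) (expand_det_row _ ord0).
  rewrite mulr_sumr; apply: eq_bigr => p _; rewrite !mxE ltnn addn0 add0n.
  rewrite /cofactor /= add0n exprD -mulrA [LHS]mulrCA.
  congr (_ * (_ * (_ * \det _))).
  apply/matrixP => a q; rewrite !mxE /= /bump (leqNgt n) ltn_ord /= add0n.
  by rewrite ltn_ord addn1 add1n.
rewrite mulrACA -exprD mulVf // mulr1 -signr_odd.
by rewrite !addSn /= addnn odd_double.
Qed.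

(** * Reversed polynomials *)

(** Reversal z^n p(1/z) with respect to the nominal degree n; it turns
    expansions at infinity into expansions at zero. *)
Definition mirror (R : nzRingType) (n : nat) (p : {poly R}) : {poly R} :=
  \sum_(i < n.+1) p`_i *: 'X^(n - i).

Fact mirror_is_linear (R : nzRingType) (n : nat) : linear (@mirror R n).
Proof.
move=> a p q; rewrite /mirror scaler_sumr -big_split /=; apply: eq_bigr => i _.
by rewrite coefD coefZ scalerDl scalerA.
Qed.

HB.instance Definition _ (R : nzRingType) (n : nat) :=
  GRing.isLinear.Build R {poly R} {poly R} *:%R (@mirror R n)
    (@mirror_is_linear R n).

Lemma mirror_Xn (R : nzRingType) (n k : nat) :
  (k <= n)%N -> mirror n ('X^k : {poly R}) = 'X^(n - k).
Proof.
move=> le_kn; rewrite /mirror (bigD1 (Ordinal (le_kn : (k < n.+1)%N))) //=.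
rewrite coefXn eqxx scale1r big1 ?addr0 // => i.
rewrite -val_eqE /= => /negPf ik.
by rewrite coefXn ik scale0r.
Qed.

Lemma mirrorM (R : comNzRingType) (n m : nat) (p q : {poly R}) :
  (size p <= n.+1)%N -> (size q <= m.+1)%N ->
  mirror (n + m) (p * q) = mirror n p * mirror m q.
Proof.
move=> le_pn le_qm; rewrite {1}(poly_sum_widen le_pn) {1}(poly_sum_widen le_qm).
rewrite mulr_suml linear_sum /= [RHS]mulr_suml; apply: eq_bigr => i _.
rewrite mulr_sumr linear_sum /= [RHS]mulr_sumr; apply: eq_bigr => k _.
rewrite -!scalerAl -!scalerAr !linearZ /= -!exprD mirror_Xn.
  rewrite !scalerA mulrC; congr (_ *: 'X^_).
  by have := ltn_ord i; have := ltn_ord k; lia.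
by have := ltn_ord i; have := ltn_ord k; lia.
Qed.

Lemma size_mirror (R : nzRingType) (n : nat) (p : {poly R}) :
  (size (mirror n p) <= n.+1)%N.
Proof.
apply: leq_trans (size_sum _ _ _) _; apply/bigmax_leqP => i _.
by apply: leq_trans (size_scale_leq _ _) _; rewrite size_polyXn; lia.
Qed.

Lemma coef_mirror (R : nzRingType) (n k : nat) (p : {poly R}) :
  (k <= n)%N -> (mirror n p)`_k = p`_(n - k).
Proof.
move=> le_kn; have lt_nk : (n - k < n.+1)%N by lia.
rewrite coef_sum (bigD1 (Ordinal lt_nk)) //= coefZ coefXn.
rewrite subKn // eqxx mulr1 big1 ?addr0 // => i; rewrite -val_eqE /= => /eqP ik.
rewrite coefZ coefXn; case: eqP => [ki|_]; rewrite ?mulr0 //.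
by case: ik; have := ltn_ord i; lia.
Qed.

Lemma mirror_widen (R : comNzRingType) (n m : nat) (p : {poly R}) :
  (size p <= n.+1)%N -> mirror (m + n) p = 'X^m * mirror n p.
Proof.
move=> le_pn; rewrite -{1}[p]mul1r mirrorM // ?size_poly1 //.
by congr (_ * _); rewrite -(expr0 'X) mirror_Xn // subn0.
Qed.

(** Through this identity the expansion of G f_0 at infinity, in reversed form,
    yields the orthogonality properties of G. *)
Lemma coef_mirror_moment (R : realType) (s : seq R) (n k : nat) (G : {poly R}) :
  (size G <= n.+1)%N ->
  (mirror n G * Poly s)`_(n + k) = moment s (G * 'X^k).
Proof.
move=> le_Gn; rewrite (moment_mulXn _ _ le_Gn) /mirror mulr_suml coef_sum.
apply: eq_bigr => i _; rewrite -scalerAl coefZ coefXnM coef_Poly.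
have lt_in := ltn_ord i; rewrite ltnNge (_ : (n - i <= n + k)%N); last by lia.
by congr (_ * s`__); lia.
Qed.

(** * Truncated inverses *)

Lemma poly_eq_upto (R : nzRingType) (k : nat) (p q : {poly R}) :
  (forall i, (i < k)%N -> p`_i = q`_i) -> exists e, p = q + 'X^k * e.
Proof.
move=> pq; exists (drop_poly k (p - q)); apply/polyP => i.
rewrite coefD coefXnM coef_drop_poly; case: ltnP => [/pq ->|le_ki].
  by rewrite addr0.
by rewrite subnK // coefB addrC subrK.
Qed.

Lemma toeplitz_inverse (R : realType) (k : nat) (c d : seq R) :
  toeplitz k c *m toeplitz k d = 1%:M ->
  exists e : {poly R}, Poly c * Poly d = 1 + 'X^k * e.
Proof.
move=> cd; apply: poly_eq_upto => i lt_ik.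
have lt0k : (0 < k)%N by apply: leq_ltn_trans lt_ik.
have := congr1 (fun A : 'M_k => A (Ordinal lt0k) (Ordinal lt_ik)) cd.
rewrite !mxE -val_eqE /= coef1 eq_sym => <-; rewrite coefM.
rewrite (big_ord_widen _ (fun p => (Poly c)`_p * (Poly d)`_(i - p)) lt_ik).
rewrite big_mkcond /=; apply: eq_bigr => p _; rewrite !mxE /=.
rewrite subn0 ltnS !coef_Poly.
by case: ifP => // _; rewrite mulr0.
Qed.

Lemma Poly_drop (R : nzRingType) (n : nat) (t : seq R) :
  (forall i, (i < n)%N -> t`_i = 0) -> Poly t = 'X^n * Poly (drop n t).
Proof.
move=> t0; apply/polyP => i; rewrite coefXnM !coef_Poly.
by case: ltnP => [/t0 //|le_ni]; rewrite nth_drop subnKC.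
Qed.

(** The reversed m_j is the inverse of the moment series of t, up to the
    power that m_j can reach; this is the first Toeplitz equation truncated, and
    it is available for the last index j = N as well. *)
Lemma schur_m_inverse (R : realType) (t : seq R) (n : nat) :
  (forall i, (i < n)%N -> t`_i = 0) -> t`_n != 0 ->
  exists e : {poly R},
    mirror n (schur_m t n.+1) * Poly (drop n t) = 1 + 'X^(n.+1) * e.
Proof.
move=> t0 tn; apply: poly_eq_upto => i lt_in.
rewrite coef1 -(schur_m_moment t0 tn lt_in).
rewrite -(coef_mirror_moment _ _ (size_schur_m t n)) (Poly_drop t0) mulrCA.
by rewrite coefXnM ltnNge leq_addr /= addKn.
Qed.

Lemma schur_m_top (R : realType) (t : seq R) (n : nat) :
  (forall i, (i < n)%N -> t`_i = 0) -> t`_n != 0 ->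
  (schur_m t n.+1)`_n * t`_n = 1.
Proof.
move=> t0 tn; have [e] := schur_m_inverse t0 tn.
move=> /(congr1 (fun p : {poly R} => p`_0)).
rewrite coef0M coef_mirror // subn0 coef_Poly nth_drop addn0 => ->.
by rewrite coefD coefXnM coef1 addr0.
Qed.

(** The first row of the first Toeplitz matrix, as a polynomial. *)
Lemma Poly_rev_mirror (R : nzRingType) (n : nat) (m : {poly R}) (f : seq R) :
  Poly (rev (mkseq (fun i => m`_i) n.+1) ++ map -%R f) =
  mirror n m - 'X^(n.+1) * Poly f.
Proof.
apply/polyP => i; rewrite coef_Poly coefB coefXnM nth_cat size_rev size_mkseq.
case: ltnP => [lt_in|le_ni].
  rewrite nth_rev size_mkseq // nth_mkseq ?subr0; last by lia.
  by rewrite coef_mirror // subSS.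
rewrite (nth_default 0 (leq_trans (size_mirror _ _) le_ni)) sub0r coef_Poly.
have [lt_if|le_fi] := ltnP (i - n.+1) (size f); first by rewrite (nth_map 0).
by rewrite !nth_default ?oppr0 ?size_map.
Qed.

(** * Remainders of the continued fraction *)

(** Up to sign, A f_0 - B in the variable w = 1/z, multiplied by w^n: the
    series f_0 is - w Poly s, B is the polynomial part and hence has degree at
    most n after reversal, and rho is the remainder divided by w^n.  Moments
    beyond the end of [s] are unknown, whence the modulus. *)
Definition odd_expansion (R : realType) (s : seq R) (n : nat)
    (Ao rho : {poly R}) : Prop :=
  (size Ao <= n.+1)%N /\
  exists B c : {poly R}, (size B <= n.+1)%N /\
    mirror n Ao * ('X * Poly s) + B =
    'X^(2 * n) * rho + 'X^((size s).+1) * c.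

(** The relation R_(2j) = - f_j R_(2j-1): the remainder is the odd one, given
    by the same rho, times the series w Poly t of the sequence t = s^(j). *)
Definition even_expansion (R : realType) (s : seq R) (n : nat)
    (Ae rho : {poly R}) (t : seq R) : Prop :=
  size Ae = n.+1 /\
  exists B c : {poly R}, (size B <= n.+1)%N /\
    mirror n Ae * ('X * Poly s) + B =
    'X^(2 * n) * (rho * ('X * Poly t)) + 'X^((size s).+1) * c.

(** The coefficients of w^(n + k + 1) avoid both the polynomial part B and
    the truncation error. *)
Lemma moment_expansion (R : realType) (s : seq R) (n k : nat)
    (A B rho c : {poly R}) :
  (size A <= n.+1)%N -> (size B <= n.+1)%N -> (n + k < size s)%N ->
  mirror n A * ('X * Poly s) + B = 'X^(2 * n) * rho + 'X^((size s).+1) * c ->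
  moment s (A * 'X^k) = if (k.+1 < n)%N then 0 else rho`_(k.+1 - n).
Proof.
move=> le_An le_Bn lt_ks /(congr1 (fun p : {poly R} => p`_(n + k).+1)).
rewrite mulrCA !coefD coefXM /= (coef_mirror_moment _ _ le_An) !coefXnM.
rewrite (nth_default 0 (leq_trans le_Bn _)) ?addr0; last first.
  by rewrite ltnS leq_addr.
rewrite ltnS lt_ks addr0 => ->.
have -> : ((n + k).+1 < 2 * n)%N = (k.+1 < n)%N by lia.
by case: ifP => // _; congr (_`__); lia.
Qed.

Lemma orthogonal_odd_expansion (R : realType) (s : seq R) (n : nat)
    (Ao rho : {poly R}) :
  odd_expansion s n Ao rho -> (2 * n <= (size s).+1)%N ->
  orthogonal s Ao n.-1.
Proof.
case=> le_A [B [c [le_B eq_A]]] le_ns k lt_kn.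
by rewrite (moment_expansion le_A le_B _ eq_A); [case: ltnP => //|]; lia.
Qed.

Lemma coef_mul_low (R : nzRingType) (mu j : nat) (p q : {poly R}) :
  (forall i, (i < mu)%N -> q`_i = 0) -> (j <= mu)%N ->
  (p * q)`_j = p`_0 * q`_j.
Proof.
move=> q0 le_j; rewrite coefM big_ord_recl /= subn0 big1 ?addr0 // => i _.
by rewrite q0 ?mulr0 //= /bump /=; have := ltn_ord i; lia.
Qed.

Lemma moment_even_expansion (R : realType) (s t : seq R) (n mu k : nat)
    (Ae rho : {poly R}) :
  even_expansion s n Ae rho t -> (forall i, (i < mu)%N -> t`_i = 0) ->
  (n + k < size s)%N -> (k <= n + mu)%N ->
  moment s (Ae * 'X^k) = if (k < n)%N then 0 else rho`_0 * t`_(k - n).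
Proof.
case=> size_A [B [c [le_B eq_A]]] t0 lt_ks le_k.
rewrite (moment_expansion _ le_B lt_ks eq_A) ?size_A //.
rewrite mulrCA coefXM.
have [lt_kn|le_nk] := ltnP k n.
  by case: ltnP => // le_nk; rewrite (_ : (k.+1 - n)%N = 0%N) //; lia.
rewrite ltnNge (leqW le_nk) /= subSn //= (@coef_mul_low _ mu) ?coef_Poly //.
  by move=> i /t0; rewrite coef_Poly.
by lia.
Qed.

Lemma orthogonal_even_expansion (R : realType) (s t : seq R) (n mu : nat)
    (Ae rho : {poly R}) :
  even_expansion s n Ae rho t -> (forall i, (i < mu)%N -> t`_i = 0) ->
  (2 * n + mu <= size s)%N -> orthogonal s Ae (n + mu).
Proof.
move=> eA t0 le_s k lt_k; rewrite (moment_even_expansion eA t0); try lia.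
by case: ltnP => // le_nk; rewrite t0 ?mulr0 //; lia.
Qed.

(** Until the first nonzero entry of t, A stays orthogonal; D at the next
    normal index is nonzero, so such an entry exists with index at most nu, and
    by [hankel_neq0_next] its index is tied to a normal index, which leaves only
    nu. *)
Lemma first_entry (R : realType) (s t : seq R) (n nu : nat)
    (Ae rho : {poly R}) :
  even_expansion s n Ae rho t -> rho`_0 != 0 ->
  D s n != 0 -> D s (n + nu).+1 != 0 ->
  (forall x, (n < x < (n + nu).+1)%N -> D s x = 0) ->
  (2 * n + nu < size s)%N ->
  (forall i, (i < nu)%N -> t`_i = 0) /\ t`_nu != 0.
Proof.
move=> eA rho0 Dn Dnext Dbetween le_s.
have size_A := eA.1.
have [t0|] := boolP [forall i : 'I_nu.+1, t`_i == 0].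
  have/eqP : Ae = 0; last by rewrite -size_poly_eq0 size_A.
  apply: (hankel_neq0_orthogonal Dnext); first by rewrite size_A; lia.
  rewrite -addnS; apply: (orthogonal_even_expansion eA); last by lia.
  by move=> i lt_i; apply/eqP/(forallP t0 (Ordinal lt_i)).
rewrite negb_forall => /existsP [i0 ti0].
have ex_t : exists i, t`_i != 0 by exists i0.
case: (ex_minnP ex_t) => mu tmu min_mu.
have t0 i : (i < mu)%N -> t`_i = 0.
  move=> lt_i; apply/eqP/negbNE; apply: contraL lt_i => /min_mu.
  by rewrite -leqNgt.
have le_mu : (mu <= nu)%N by apply: leq_trans (min_mu _ ti0) _; rewrite -ltnS.
suff -> : nu = mu by [].
apply/eqP; rewrite eqn_leq le_mu andbT leqNgt; apply/negP => lt_mu.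
have /eqP[] : D s (n + mu).+1 != 0; last by apply: Dbetween; lia.
apply: (hankel_neq0_next Dn size_A).
  by apply: (orthogonal_even_expansion eA t0); lia.
rewrite (moment_even_expansion eA t0); try lia.
by rewrite ltnNge leq_addr /= addKn mulf_neq0.
Qed.

(** * One step of the continued fraction *)

Lemma size_mul_bound (R : nzRingType) (a b : nat) (p q : {poly R}) :
  (size p <= a.+1)%N -> (size q <= b.+1)%N -> (size (p * q)%R <= (a + b).+1)%N.
Proof.
move=> le_p le_q; apply: leq_trans (size_polyMleq p q) _.
by case: (size p) (size q) le_p le_q => [|x] [|y] /=; lia.
Qed.

Lemma mirror_odd_step (R : comNzRingType) (n nu : nat) (Ao Ae m : {poly R}) :
  (size Ao <= n.+1)%N -> (size Ae <= n.+1)%N -> (size m <= nu.+1)%N ->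
  mirror (nu.+1 + n) (Ao - 'X * m * Ae) =
  'X^(nu.+1) * mirror n Ao - mirror nu m * mirror n Ae.
Proof.
move=> le_Ao le_Ae le_m.
have le_Xm : (size ('X * m)%R <= nu.+2)%N.
  by rewrite -[nu.+1]add1n; apply: size_mul_bound; rewrite ?size_polyX.
rewrite linearB /= mirror_widen // mirrorM //; congr (_ - _ * _).
rewrite -[nu.+1]add1n mirrorM ?size_polyX // -{1}['X]expr1.
by rewrite mirror_Xn // mul1r.
Qed.

Lemma size_odd_step (R : comNzRingType) (n nu : nat) (Ao Ae m : {poly R}) :
  (size Ao <= n.+1)%N -> (size Ae <= n.+1)%N -> (size m <= nu.+1)%N ->
  (size (Ao - 'X * m * Ae)%R <= (nu.+1 + n).+1)%N.
Proof.
move=> le_Ao le_Ae le_m.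
rewrite (leq_trans (size_polyD _ _)) // geq_max size_polyN; apply/andP; split.
  by apply: leq_trans le_Ao _; lia.
apply: size_mul_bound => //; rewrite -[nu.+1]add1n.
by apply: size_mul_bound; rewrite ?size_polyX.
Qed.

(** From A_(2j) and A_(2j-1) to A_(2j+1): the leading part of the remainder
    is killed because the reversed m inverts the series of t. *)
Lemma odd_expansion_step (R : realType) (s t : seq R) (n nu : nat)
    (Ao Ae m rho e : {poly R}) :
  odd_expansion s n Ao rho -> even_expansion s n Ae rho t ->
  (forall i, (i < nu)%N -> t`_i = 0) -> (size m <= nu.+1)%N ->
  mirror nu m * Poly (drop nu t) = 1 + 'X^(nu.+1) * e ->
  odd_expansion s (nu.+1 + n) (Ao - 'X * m * Ae) (- (rho * e)).
Proof.
case=> le_Ao [Bo [co [le_Bo eq_Ao]]] [size_Ae [Be [ce [le_Be eq_Ae]]]].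
move=> t0 le_m eq_m; have le_Ae : (size Ae <= n.+1)%N by rewrite size_Ae.
split; first exact: size_odd_step.
exists ('X^(nu.+1) * Bo - mirror nu m * Be),
  ('X^(nu.+1) * co - mirror nu m * ce).
split.
  rewrite (leq_trans (size_polyD _ _)) // geq_max size_polyN; apply/andP; split.
    by apply: size_mul_bound; rewrite ?size_polyXn.
  by rewrite addSn -addnS; exact: size_mul_bound (size_mirror _ _) (leqW le_Be).
rewrite mirror_odd_step //.
transitivity ('X^(nu.+1) * (mirror n Ao * ('X * Poly s) + Bo)
   - mirror nu m * (mirror n Ae * ('X * Poly s) + Be)); first by ring.
rewrite eq_Ao eq_Ae (Poly_drop t0).
have -> : (2 * (nu.+1 + n) = nu.+1 + nu.+1 + 2 * n)%N by lia.
transitivity ('X^(nu.+1) * 'X^(2 * n) * rho *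
   (1 - mirror nu m * Poly (drop nu t)) + 'X^((size s).+1) *
   ('X^(nu.+1) * co - mirror nu m * ce)); first by rewrite exprS; ring.
by rewrite eq_m !exprD; ring.
Qed.

(** From A_(2j+1) to A_(2j+2): the relation assumed on e says that e is, up
    to truncation, the series of t divided by l - w t', so the new odd remainder
    is the old one times f_j / (l_(j+1) + f_(j+1)). *)
Lemma even_expansion_step (R : realType) (s t t' : seq R) (n nu k : nat)
    (Ae Ao' rho e c : {poly R}) (l : R) :
  even_expansion s n Ae rho t ->
  odd_expansion s (nu.+1 + n) Ao' (- (rho * e)) ->
  (forall i, (i < nu)%N -> t`_i = 0) -> size Ao' = (nu.+1 + n).+1 -> l != 0 ->
  (2 * (nu.+1 + n) + k = (size s).+1)%N ->
  e * (l%:P - 'X * Poly t') = Poly (drop nu t) + 'X^k * c ->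
  even_expansion s (nu.+1 + n) (Ae + l *: Ao') (- (rho * e)) t'.
Proof.
case=> size_Ae [Be [ce [le_Be eq_Ae]]] [_ [Bo [co [le_Bo eq_Ao]]]].
move=> t0 size_Ao l_neq0 eq_k eq_e.
split.
  by rewrite addrC size_polyDl size_scale ?size_Ao // size_Ae; lia.
exists ('X^(nu.+1) * Be + l%:P * Bo), ('X^(nu.+1) * ce + l%:P * co - rho * c).
split.
  rewrite (leq_trans (size_polyD _ _)) // geq_max mul_polyC; apply/andP; split.
    by apply: size_mul_bound; rewrite ?size_polyXn.
  exact: leq_trans (size_scale_leq _ _) le_Bo.
rewrite linearD linearZ /= mirror_widen ?size_Ae // -mul_polyC.
transitivity ('X^(nu.+1) * (mirror n Ae * ('X * Poly s) + Be) +
   l%:P * (mirror (nu.+1 + n) Ao' * ('X * Poly s) + Bo)); first by ring.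
rewrite eq_Ae eq_Ao (Poly_drop t0) -eq_k.
have -> : Poly (drop nu t) = e * (l%:P - 'X * Poly t') - 'X^k * c.
  by rewrite eq_e addrK.
have -> : (2 * (nu.+1 + n) = nu + 1 + (nu + 1) + 2 * n)%N by lia.
have -> : (nu.+1 = nu + 1)%N by rewrite addn1.
by rewrite !exprD expr1; ring.
Qed.

(** * Normal indices *)

Lemma nidx_lt (R : realType) (s : seq R) (i j : nat) :
  (i < j)%N -> (j <= size (normal_indices s))%N -> (nidx s i < nidx s j)%N.
Proof.
move=> lt_ij le_j.
have sorted_n : sorted ltn (0%N :: normal_indices s).
  rewrite /= path_min_sorted; last first.
    by apply/allP => x; rewrite mem_filter mem_iota => /andP[_ /andP[]].
  exact: sorted_filter ltn_trans _ _ (iota_ltn_sorted _ _).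
by apply: (sorted_ltn_nth ltn_trans 0%N sorted_n) => //; rewrite inE /=; lia.
Qed.

Lemma nidx_le (R : realType) (s : seq R) (i j : nat) :
  (i <= j)%N -> (j <= size (normal_indices s))%N -> (nidx s i <= nidx s j)%N.
Proof.
rewrite leq_eqVlt => /predU1P[->//|lt_ij] le_j.
exact: ltnW (nidx_lt lt_ij le_j).
Qed.

Lemma hankel_nidx (R : realType) (s : seq R) (j : nat) :
  (j <= size (normal_indices s))%N -> D s (nidx s j) != 0.
Proof.
case: j => [|j] le_j; first by rewrite /nidx hankel0 oner_eq0.
by have := mem_nth 0%N le_j; rewrite mem_filter => /andP[].
Qed.

Lemma hankel_between (R : realType) (s : seq R) (j x : nat) :
  (j < size (normal_indices s))%N -> (nidx s j < x < nidx s j.+1)%N ->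
  D s x = 0.
Proof.
move=> lt_j /andP[lt_jx lt_xj]; apply/eqP/negbNE/negP => Dx.
have mem_last : nidx s j.+1 \in normal_indices s by apply: mem_nth.
have xn : x \in normal_indices s.
  rewrite mem_filter Dx mem_iota /=; move: mem_last.
  by rewrite mem_filter mem_iota => /andP[_]; lia.
have lt_i : (index x (normal_indices s) < size (normal_indices s))%N.
  by rewrite index_mem.
have xE : x = nidx s (index x (normal_indices s)).+1.
  by rewrite /nidx /= nth_index.
have [le_ij|lt_ji] := leqP (index x (normal_indices s)).+1 j.
  by have := nidx_le le_ij (ltnW lt_j); rewrite -xE; lia.
by have := nidx_le lt_ji lt_i; rewrite -xE; lia.
Qed.

(** * The Schur algorithm *)

(** The pairs (A_(2j-1), A_(2j)), that is, the solution of the P-half of (R)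
    for arbitrary parameters. *)
Fixpoint denominators (R : realType) (m : nat -> {poly R}) (l : nat -> R)
    (j : nat) : {poly R} * {poly R} :=
  if j is i.+1 then
    let A := denominators m l i in
    let Ao := A.1 - 'X * m i.+1 * A.2 in (Ao, A.2 + l i.+1 *: Ao)
  else (0, 1).

Lemma denominators_at0 (R : realType) (m : nat -> {poly R}) (l : nat -> R)
    (j : nat) :
  (denominators m l j).1.[0] = 0 /\ (denominators m l j).2.[0] = 1.
Proof.
elim: j => [|j [IHo IHe]] /=; first by rewrite !hornerE.
by rewrite !hornerE IHo IHe; split; ring.
Qed.

(** What the Schur algorithm has achieved after j steps; rho_0 <> 0 says
    that the remainder R_(2j-1) has order exactly n_j. *)
Definition schur_invariant (R : realType) (s : seq R) (ss fs : nat -> seq R)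
    (j : nat) : Prop :=
  let A := denominators (mpar s ss) (lpar s ss) j in
  exists rho : {poly R}, [/\ rho`_0 != 0,
    odd_expansion s (nidx s j) A.1 rho,
    even_expansion s (nidx s j) A.2 rho (ss j)
  & size (ss j) = (size s - 2 * nidx s j)%N].

Lemma schur_invariant0 (R : realType) (s : seq R) (ss fs : nat -> seq R) :
  ss 0%N = s -> schur_invariant s ss fs 0.
Proof.
move=> ss0; exists 1; rewrite ss0 /nidx /= muln0 subn0 coef1 oner_eq0.
have m1 : mirror 0 1 = 1 :> {poly R}.
  by rewrite -(expr0 'X) mirror_Xn ?subn0.
split=> //; split; rewrite ?size_poly0 ?size_poly1 //.
  exists 1, 0; rewrite size_poly1 linear0 expr0; split=> //.
  by rewrite mul0r mulr0 mulr1 add0r addr0.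
exists 0, 0; rewrite size_poly0 m1 expr0; split=> //.
by rewrite mulr0 !mul1r.
Qed.

Lemma gapS (R : realType) (s : seq R) (j : nat) :
  (j < size (normal_indices s))%N -> gap s j.+1 = (gap s j.+1).-1.+1.
Proof.
by move=> lt_j; rewrite /gap /=; have := nidx_lt (ltnSn j) lt_j; lia.
Qed.

Lemma nidxS (R : realType) (s : seq R) (j : nat) :
  (j < size (normal_indices s))%N -> nidx s j.+1 = (gap s j.+1 + nidx s j)%N.
Proof.
by move=> lt_j; rewrite /gap /=; have := nidx_lt (ltnSn j) lt_j; lia.
Qed.

(** The sequence is just long enough for its last normal index. *)
Definition ends_at_normal_index (R : realType) (s : seq R) : Prop :=
  size s = (2 * nidx s (size (normal_indices s)) - 1)%N.

Lemma invariant_first_entry (R : realType) (s : seq R) (ss fs : nat -> seq R)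
    (j : nat) :
  ends_at_normal_index s -> (j < size (normal_indices s))%N ->
  schur_invariant s ss fs j ->
  (forall i, (i < (gap s j.+1).-1)%N -> (ss j)`_i = 0) /\
  (ss j)`_(gap s j.+1).-1 != 0.
Proof.
move=> size_s lt_j [rho [rho0 _ eA size_ss]].
have nE : (nidx s j + (gap s j.+1).-1).+1 = nidx s j.+1.
  by have := nidxS lt_j; have := gapS lt_j; lia.
apply: (first_entry eA rho0).
- exact/hankel_nidx/ltnW.
- by rewrite nE; apply: hankel_nidx.
- by move=> x; rewrite nE; apply: hankel_between.
- by have := nidx_le lt_j (leqnn _); move: nE; rewrite size_s; lia.
Qed.

Lemma orthogonal_odd_denominator (R : realType) (s : seq R)
    (ss fs : nat -> seq R) (j : nat) :
  ends_at_normal_index s -> (j < size (normal_indices s))%N ->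
  schur_invariant s ss fs j ->
  orthogonal s (denominators (mpar s ss) (lpar s ss) j.+1).1
    (nidx s j.+1).-1.
Proof.
move=> size_s lt_j st; have [t0 tn] := invariant_first_entry size_s lt_j st.
have [rho [rho0 oA eA size_ss]] := st.
have [e eq_m] := schur_m_inverse t0 tn.
apply: (@orthogonal_odd_expansion _ _ _ _ (- (rho * e))); last first.
  by have := nidx_le lt_j (leqnn _); rewrite size_s; lia.
rewrite (nidxS lt_j) /= {1}(gapS lt_j) /mpar /= (gapS lt_j).
exact: odd_expansion_step oA eA t0 (size_schur_m _ _) eq_m.
Qed.

Lemma orthogonal_even_denominator (R : realType) (s : seq R)
    (ss fs : nat -> seq R) (j : nat) :
  ends_at_normal_index s -> (j < size (normal_indices s))%N ->
  schur_invariant s ss fs j ->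
  let Ae := (denominators (mpar s ss) (lpar s ss) j).2 in
  [/\ size Ae = (nidx s j).+1, orthogonal s Ae (nidx s j.+1).-1
    & moment s (Ae * 'X^((nidx s j.+1).-1)) != 0].
Proof.
move=> size_s lt_j st; have [t0 tn] := invariant_first_entry size_s lt_j st.
have [rho [rho0 oA eA size_ss]] := st; move=> Ae.
have le_N := nidx_le lt_j (leqnn _).
have nS := nidxS lt_j; have gS := gapS lt_j.
have nE : (nidx s j.+1).-1 = (nidx s j + (gap s j.+1).-1)%N by lia.
split; first exact: eA.1.
  by rewrite nE; apply: (orthogonal_even_expansion eA t0); rewrite size_s; lia.
rewrite nE (moment_even_expansion eA t0); try (rewrite ?size_s; lia).
by rewrite ltnNge leq_addr /= addKn mulf_neq0.
Qed.

Lemma Poly_cons_opp (R : nzRingType) (l : R) (f : seq R) :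
  Poly (l :: map -%R f) = l%:P - 'X * Poly f.
Proof.
apply/polyP => -[|i]; rewrite coef_Poly coefB coefC coefXM /= ?subr0 // sub0r.
rewrite coef_Poly; have [lt_i|le_i] := ltnP i (size f).
  by rewrite (nth_map 0).
by rewrite !nth_default ?oppr0 ?size_map.
Qed.

(** With x y the modulus of the first Toeplitz equation, m the reversed m_j
    and F the series of the auxiliary sequence, this isolates the factor e of
    [odd_expansion_step]. *)
Lemma cofactor_shift (A : comNzRingType) (m U F x y c : A) :
  (m - x * F) * U = 1 + x * y * c -> m * U = 1 + x * (F * U + y * c).
Proof.
move=> eq_m; transitivity ((m - x * F) * U + x * F * U); first by ring.
by rewrite eq_m; ring.
Qed.

(** The second Toeplitz equation, saying that L inverts F, turns the factor e
    into the quotient required by [even_expansion_step]. *)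
Lemma cofactor_cancel (A : comNzRingType) (L F U y c c' : A) :
  L * F = 1 + y * c' -> (F * U + y * c) * L = U + y * (c' * U + c * L).
Proof.
move=> eq_l; transitivity (L * F * U + y * c * L); first by ring.
by rewrite eq_l; ring.
Qed.

(** The Toeplitz equations provide the factor e and also l_j <> 0 and
    e_0 <> 0, so that degrees and the order of the remainder propagate. *)
Lemma schur_invariant_step (R : realType) (s : seq R) (ss fs : nat -> seq R)
    (j : nat) :
  ends_at_normal_index s -> (j.+1 < size (normal_indices s))%N ->
  schur_step s ss fs j.+1 -> schur_invariant s ss fs j ->
  schur_invariant s ss fs j.+1.
Proof.
move=> size_s lt_j step st; have lt_j' := ltnW lt_j.
have [t0 tn] := invariant_first_entry size_s lt_j' st.
have [rho [rho0 oA eA size_ss]] := st.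
have nS := nidxS lt_j'; have gS := gapS lt_j'.
have le_N := nidx_le lt_j' (leqnn _).
have lt_N := nidx_lt lt_j (leqnn _).
case: step => size_ss' size_fs; rewrite /= gS subn1 /=.
set nu := (gap s j.+1).-1 in gS t0 tn *.
move=> Tm Tl; have [c0] := toeplitz_inverse Tm.
have [c1] := toeplitz_inverse Tl.
rewrite Poly_rev_mirror Poly_cons_opp => eq_l eq_m.
(* eq_m and eq_l are the two Toeplitz equations in terms of series. *)
have mE : mpar s ss j.+1 = schur_m (ss j) nu.+1 by rewrite /mpar /= gS.
rewrite mE in eq_m; set m := schur_m _ _ in mE eq_m.
set l := lpar _ _ _ in eq_l *; set k := size (fs j.+1) in eq_l eq_m.
have eq_k : (2 * (nu.+1 + nidx s j) + k = (size s).+1)%N.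
  by rewrite /k size_fs size_ss' size_s; lia.
have k_gt0 : (0 < k)%N by rewrite /k size_fs.
pose e := Poly (fs j.+1) * Poly (drop nu (ss j)) + 'X^k * c0.
have eq_e : mirror nu m * Poly (drop nu (ss j)) = 1 + 'X^(nu.+1) * e.
  by apply: cofactor_shift; rewrite -exprD.
have eq_el : e * (l%:P - 'X * Poly (ss j.+1)) = Poly (drop nu (ss j)) +
    'X^k * (c1 * Poly (drop nu (ss j)) + c0 * (l%:P - 'X * Poly (ss j.+1))).
  exact: cofactor_cancel eq_l.
have [l_neq0 e_neq0] : l != 0 /\ e`_0 != 0.
  have /eqP := congr1 (fun p : {poly R} => p`_0) eq_el.
  rewrite coef0M coefB coefC coefXM subr0 coefD coefXnM k_gt0 addr0.
  rewrite coef_Poly nth_drop addn0 => /eqP el.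
  by move: tn; rewrite -el mulf_eq0 negb_or => /andP[].
have oA' := odd_expansion_step oA eA t0 (size_schur_m _ _) eq_e.
have size_Ao' : size (denominators (mpar s ss) (lpar s ss) j.+1).1 =
    (nu.+1 + nidx s j).+1.
  rewrite /= mE.
  have m_neq0 : m`_nu != 0.
    have := schur_m_top t0 tn; apply: contra_eq_neq => ->.
    by rewrite mul0r eq_sym oner_eq0.
  have size_m : size m = nu.+1.
    apply/eqP; rewrite eqn_leq size_schur_m ltnNge; apply/negP => le_m.
    by rewrite nth_default ?eqxx in m_neq0.
  have m0 : m != 0 by rewrite -size_poly_eq0 size_m.
  have A0 : (denominators (mpar s ss) (lpar s ss) j).2 != 0.
    by rewrite -size_poly_eq0 eA.1.
  have size_mA : size ('X * m * (denominators (mpar s ss) (lpar s ss) j).2) =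
      (nu.+1 + nidx s j).+1.
    rewrite -mulrA mulrC size_mulX ?mulf_neq0 // size_mul // size_m eA.1.
    by rewrite addSn addnS.
  rewrite addrC size_polyDl size_polyN size_mA //.
  by apply: leq_ltn_trans oA.1 _; rewrite addSn ltnS ltnS leq_addl.
exists (- (rho * e)); rewrite nS; split.
- by rewrite coefN oppr_eq0 coef0M mulf_neq0.
- by rewrite /= mE gS.
- rewrite gS; apply: (even_expansion_step eA _ t0 size_Ao' l_neq0 eq_k eq_el).
  by rewrite /= mE.
- by rewrite size_ss' nS.
Qed.

Lemma schur_invariants (R : realType) (s : seq R) (ss fs : nat -> seq R) :
  ends_at_normal_index s -> schur_sequences s ss fs ->
  forall j, (j < size (normal_indices s))%N -> schur_invariant s ss fs j.
Proof.
move=> size_s [ss0 steps]; elim=> [|j IH] lt_j; first exact: schur_invariant0.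
by apply: schur_invariant_step size_s lt_j (steps j.+1 lt_j) (IH (ltnW lt_j)).
Qed.

(** * From the recurrences to the transfer matrices *)

Lemma det_mx2 (A : comNzRingType) (a b c d : A) :
  \det (mx2 a b c d) = a * d - b * c.
Proof.
rewrite (expand_det_row _ ord0) !big_ord_recl big_ord0 /cofactor !det_mx11.
by rewrite !mxE /= expr0 expr1; ring.
Qed.

Lemma mulmx2 (A : nzRingType) (a b c d a' b' c' d' : A) :
  mx2 a b c d * mx2 a' b' c' d' =
  mx2 (a * a' + b * c') (a * b' + b * d') (c * a' + d * c') (c * b' + d * d').
Proof.
apply/matrixP => i j; rewrite !mxE !big_ord_recl big_ord0 addr0 !mxE /=.
by case: ifP; case: ifP.
Qed.

(** Right multiplication by L_j M_(j+1) acts on each row as one even and one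
    odd step of the recurrence. *)
Lemma Wodd_recurrence (R : realType) (N : nat) (m : nat -> {poly R})
    (l : nat -> R) (Po Pe Qo Qe : nat -> {poly R}) :
  [/\ Po 0%N = 0, Pe 0%N = 1, Qo 0%N = 1 & Qe 0%N = 0] ->
  (forall j, (j < N)%N ->
     Po j.+1 = - 'X * m j.+1 * Pe j + Po j /\
     Qo j.+1 = - 'X * m j.+1 * Qe j + Qo j) ->
  (forall j, (j.+1 < N)%N ->
     Pe j.+1 = l j.+1 *: Po j.+1 + Pe j /\
     Qe j.+1 = l j.+1 *: Qo j.+1 + Qe j) ->
  forall j, (j < N)%N ->
    Wodd m l j.+1 = mx2 (Qo j.+1) (Qe j) (Po j.+1) (Pe j).
Proof.
move=> [Po0 Pe0 Qo0 Qe0] odd_rec even_rec; elim=> [|j IH] lt_j.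
  have [-> ->] := odd_rec 0%N lt_j.
  rewrite /Wodd big_geq // mul1r /Mmat Po0 Pe0 Qo0 Qe0.
  by congr mx2; ring.
rewrite /Wodd big_nat_recr //= -/(Wodd m l j.+1) mulrA.
rewrite -/(Wodd m l j.+1) IH ?(ltnW lt_j) // /Lmat /Mmat !mulmx2.
have [-> ->] := odd_rec _ lt_j; have [-> ->] := even_rec _ lt_j.
by rewrite -!mul_polyC; congr mx2; ring.
Qed.

(** * The polynomials P and Q *)

Lemma moment_rcons (R : realType) (s : seq R) (c : R) (G : {poly R}) :
  (size G <= size s)%N -> moment (rcons s c) G = moment s G.
Proof.
move=> le_G; rewrite /moment size_rcons big_ord_recr /= (nth_default 0 le_G).
by rewrite mul0r addr0; apply: eq_bigr => i _; rewrite nth_rcons ltn_ord.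
Qed.

Lemma hankel_rcons (R : realType) (s : seq R) (c : R) (n : nat) :
  (2 * n <= (size s).+1)%N -> D (rcons s c) n = D s n.
Proof.
move=> le_n; congr (\det _); apply/matrixP => i p; rewrite !mxE nth_rcons.
have lt_i := ltn_ord i; have lt_p := ltn_ord p.
have lt_ip : (i + p < size s)%N by lia.
by rewrite lt_ip.
Qed.

(** The range of k for which the moments involved stop short of the appended
    entry c. *)
Lemma orthogonal_Ppol_rcons (R : realType) (s : seq R) (c : R) (n e : nat) :
  (e <= n)%N -> (n + e <= size s)%N -> orthogonal s (Ppol (rcons s c) n) e.
Proof.
move=> le_en le_s k lt_k; rewrite -(moment_rcons c).
  by apply: orthogonal_Ppol; apply: leq_trans le_en.
have le_X : (size ('X^k : {poly R}) <= k.+1)%N by rewrite size_polyXn.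
apply: leq_trans (size_mul_bound (size_Ppol_le _ _) le_X) _.
by apply: leq_trans le_s; rewrite ltn_add2l.
Qed.

Lemma Qpol0 (R : realType) (s : seq R) : Qpol s 0 = 0.
Proof.
rewrite /Qpol Ppol0 -polyC1 map_polyC /= subrr div0p /moment_t size_poly0.
exact: big_ord0.
Qed.

(** In (P(z) - P(t)) / (z - t) the power t^n has coefficient 1 because P is
    monic, and the lower powers meet vanishing moments. *)
Lemma Qpol_first (R : realType) (t : seq R) (n : nat) :
  (forall i, (i < n)%N -> t`_i = 0) -> D t n.+1 != 0 ->
  Qpol t n.+1 = (t`_n)%:P.
Proof.
move=> t0 Dn; rewrite /Qpol /=; set P := Ppol t n.+1.
have size_P : size P = n.+2 by apply: size_Ppol.
have lead_P : lead_coef P = 1 by rewrite lead_coefE size_P coef_Ppol_top.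
have size_F : size (P%:P - map_poly polyC P) = n.+2.
  rewrite addrC size_polyDl size_polyN size_map_polyC size_P //.
  by apply: leq_ltn_trans (size_polyC_leq1 _) _.
have lead_F : lead_coef (P%:P - map_poly polyC P) = -1.
  rewrite addrC lead_coefDl ?lead_coefN ?size_polyN ?size_map_polyC ?size_P.
    by rewrite lead_coef_map_inj ?lead_P //; apply: polyC_inj.
  by apply: leq_ltn_trans (size_polyC_leq1 _) _.
have /factor_theorem [T eq_T] : root (P%:P - map_poly polyC P) 'X.
  rewrite /root !hornerE -[(map_poly polyC P).['X]]/(P \Po 'X) comp_polyXr.
  by rewrite subrr.
have lead_d : lead_coef ('X%:P - 'X : {poly {poly R}}) = -1.
  by rewrite -opprB lead_coefN lead_coefXsubC.
have TE : P%:P - map_poly polyC P = (- T) * ('X%:P - 'X).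
  by rewrite eq_T; ring.
rewrite TE Pdiv.IdomainUnit.mulpK; last by rewrite lead_d unitrN unitr1.
have T_neq0 : T != 0.
  by apply: contra_eq_neq size_F => T0; rewrite eq_T T0 mul0r size_poly0.
have size_T : size T = n.+1.
  move: size_F; rewrite eq_T size_Mmonic ?monicXsubC //.
  by rewrite size_XsubC addn2 => -[].
have lead_T : T`_n = -1.
  by rewrite -lead_F eq_T lead_coef_Mmonic ?monicXsubC // lead_coefE size_T.
rewrite /moment_t size_polyN size_T big_ord_recr /= big1 ?add0r => [|i _].
  by rewrite coefN lead_T opprK alg_polyC.
by rewrite t0 ?scale0r.
Qed.

(** * The determinantal formulas satisfy the recurrences *)

(** A multiplier x of degree d >= 1 would shift the nonzero moment of A z^e
    to the power e - d of x A. *)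
Lemma multiple_orthogonal_eq0 (R : realType) (s : seq R) (A x : {poly R})
    (e : nat) :
  orthogonal s A e -> moment s (A * 'X^e) != 0 -> orthogonal s (x * A) e ->
  x`_0 = 0 -> (size x <= e.+1)%N -> x = 0.
Proof.
move=> oA Ae oxA x0 le_x; apply/eqP/negPn/negP => x_neq0.
have size_x : (1 < size x)%N.
  rewrite ltnNge; apply: contraNN x_neq0 => le_x1.
  by rewrite (size1_polyC le_x1) x0.
have lt_k : (e.+1 - size x < e)%N by lia.
have := oxA _ lt_k.
rewrite (_ : x * A * _ = A * (x * 'X^(e.+1 - size x))); last by ring.
have size_K : size (x * 'X^(e.+1 - size x)) = e.+1.
  by rewrite size_mulXn // subnK.
rewrite (orthogonal_top oA) ?size_K // => /eqP.
rewrite mulf_eq0 (negPf Ae) orbF.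
by rewrite (negPf (coef_top_neq0 size_K)).
Qed.

(** One step of the three-term relation for a 2 x 2 determinant with the
    values at zero in its second row.  In the application u and v are inverses
    of b_0 ... b_(j-1) and of be = b_j, and x' is the inverse of x. *)
Lemma determinant_identity (A : comNzRingType)
    (f0 f1 f2 a x x' y z al u v be : A) :
  f2 = a * f1 - be * f0 -> z = al * x - be * y -> x * x' = 1 -> v * be = 1 ->
  u * v * (f2 * x - f1 * z) =
  x ^+ 2 * (u * v) * (a - al) * (x' * f1) + u * (f1 * y - f0 * x).
Proof.
move=> -> -> xx' vb; apply/eqP; rewrite -subr_eq0; apply/eqP.
transitivity ((1 - x * x') * (u * v * (a - al) * f1 * x) -
  (1 - v * be) * (u * (f1 * y - f0 * x))); first by ring.
by rewrite xx' vb subrr !mul0r subrr.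
Qed.

(** The odd polynomials of (D) without their sign, so that one statement
    covers P^+ and Q^+. *)
Definition det_odd (R : realType) (b x : nat -> R) (f : nat -> {poly R})
    (j : nat) : {poly R} :=
  (\prod_(k < j) b k)^-1 *: \det (mx2 (f j) (f j.-1) (x j)%:P (x j.-1)%:P).

Lemma det_odd_step (R : realType) (b x : nat -> R) (f : nat -> {poly R})
    (a : {poly R}) (j : nat) :
  b j.+1 *: f j - a * f j.+1 + f j.+2 = 0 ->
  b j.+1 * x j - a.[0] * x j.+1 + x j.+2 = 0 ->
  b j.+1 != 0 -> x j.+1 != 0 ->
  det_odd b x f j.+2 =
  ((x j.+1) ^+ 2 / \prod_(k < j.+2) b k) *: (a - a.[0]%:P) *
    ((x j.+1)^-1 *: f j.+1) + det_odd b x f j.+1.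
Proof.
move=> rec_f rec_x b_neq0 x_neq0; rewrite /det_odd !det_mx2 /=.
rewrite [\prod_(k < j.+2) b k]big_ord_recr /= invfM.
rewrite -!mul_polyC !polyCM -[X in X * (_ * _)]expr2.
apply: (@determinant_identity _ _ _ _ _ _ _ _ _ _ _ _ (b j.+1)%:P).
- transitivity (a * f j.+1 - (b j.+1)%:P * f j +
    (b j.+1 *: f j - a * f j.+1 + f j.+2)); last by rewrite rec_f addr0.
  by rewrite -mul_polyC; ring.
- rewrite -!polyCM -polyCB; congr (_%:P).
  transitivity (a.[0] * x j.+1 - b j.+1 * x j +
    (b j.+1 * x j - a.[0] * x j.+1 + x j.+2)); last by rewrite rec_x addr0.
  by ring.
- by rewrite -polyCM divff.
- by rewrite -polyCM mulVf.
Qed.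

Lemma orthogonal_lincomb (R : realType) (s : seq R) (a b : R)
    (A B : {poly R}) (e : nat) :
  orthogonal s A e -> orthogonal s B e -> orthogonal s (a *: A + b *: B) e.
Proof.
move=> oA oB k lt_k.
by rewrite mulrDl -!scalerAl linearD !linearZ /= oA // oB // !mulr0 addr0.
Qed.

(** Orthogonality to the powers below n_j determines a polynomial of degree
    n_j up to a factor, and the value 1 at zero fixes this factor; it also shows
    that P_(n_j) does not vanish at zero. *)
Lemma even_denominator (R : realType) (s : seq R) (ss fs : nat -> seq R)
    (c : R) (j : nat) :
  ends_at_normal_index s -> (j < size (normal_indices s))%N ->
  schur_invariant s ss fs j ->
  let p := Ppol (rcons s c) (nidx s j) in
  p.[0] != 0 /\
  (denominators (mpar s ss) (lpar s ss) j).2 = p.[0]^-1 *: p.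
Proof.
move=> size_s lt_j st p.
have [size_A oA _] := orthogonal_even_denominator size_s lt_j st.
set A := (denominators _ _ j).2 in size_A oA *.
have lt_N := nidx_lt lt_j (leqnn _); have lt_S := nidx_lt (ltnSn j) lt_j.
have le_s : (2 * nidx s j <= size s)%N by rewrite size_s; lia.
have Dj : D s (nidx s j) != 0 by apply: hankel_nidx; apply: ltnW.
have Dj' : D (rcons s c) (nidx s j) != 0 by rewrite hankel_rcons // leqW.
have size_p : size p = (nidx s j).+1 by apply: size_Ppol.
have op : orthogonal s p (nidx s j).
  by apply: orthogonal_Ppol_rcons; rewrite // addnn -mul2n.
have AE : A = A`_(nidx s j) *: p.
  apply/eqP; rewrite -subr_eq0 addrC -scaleNr; apply/eqP.
  apply: (hankel_neq0_orthogonal Dj); last first.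
    rewrite -{2}[A]scale1r; apply: orthogonal_lincomb op _ => k lt_k.
    by apply: oA; lia.
  apply/leq_sizeP => i; rewrite leq_eqVlt coefD coefZ => /predU1P[<-|lt_i].
    by rewrite coef_Ppol_top // mulr1 addNr.
  rewrite [p`_i]nth_default ?[A`_i]nth_default ?size_A ?size_p //.
  by rewrite mulr0 addr0.
have [_ A0] := denominators_at0 (mpar s ss) (lpar s ss) j.
have xA : A`_(nidx s j) * p.[0] = 1 by rewrite -hornerZ -AE A0.
have x_neq0 : p.[0] != 0.
  by apply: contra_eq_neq xA => ->; rewrite mulr0 eq_sym oner_eq0.
split=> //; rewrite {1}AE; congr (_ *: _).
by rewrite -[LHS](mulfK x_neq0) xA mul1r.
Qed.

Lemma size_Xmpar (R : realType) (s : seq R) (ss : nat -> seq R) (j : nat) :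
  (j < size (normal_indices s))%N ->
  (size ('X * mpar s ss j.+1)%R <= (gap s j.+1).+1)%N.
Proof.
move=> lt_j; rewrite /mpar (gapS lt_j) -[_.-1.+2]/((1 + (gap s j.+1).-1.+1)%N).
rewrite addnS; apply: size_mul_bound; rewrite ?size_polyX //.
exact: size_schur_m.
Qed.

(** The odd recurrences of the polynomials in (D), with a multiplier Y that
    is still to be identified with z m_(j+1).  For j > 0 it comes from the
    polynomial a_j of the three-term relation; for j = 0 it is
    (P_(n_1) - P_(n_1)(0)) / b_0, whose leading coefficient has to be compared
    with that of z m_1 since both have degree n_1. *)
Lemma determinant_quotient (R : realType) (s : seq R) (ss fs : nat -> seq R)
    (c : R) (b : nat -> R) :
  ends_at_normal_index s -> ss 0%N = s -> three_term s c b ->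
  let p j := Ppol (rcons s c) (nidx s j) in
  let q j := Qpol (rcons s c) (nidx s j) in
  let x j := (p j).[0] in
  forall j, (j < size (normal_indices s))%N -> x j != 0 ->
  exists Y : {poly R}, [/\ Y`_0 = 0,
    (size (Y - 'X * mpar s ss j.+1)%R <= nidx s j.+1)%N,
    det_odd b x p j.+1 = Y * ((x j)^-1 *: p j) +
      (if j == 0%N then 0 else det_odd b x p j)
  & det_odd b x q j.+1 = Y * ((x j)^-1 *: q j) +
      (if j == 0%N then 1 else det_odd b x q j)].
Proof.
move=> size_s ss0 [b0E three] p q x [|j] lt_j xj.
  have p0 : p 0%N = 1 by apply: Ppol0.
  have q0 : q 0%N = 0 by apply: Qpol0.
  have x0 : x 0%N = 1 by rewrite /x p0 hornerE.
  have gS := gapS lt_j; have nS := nidxS lt_j.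
  have n0 : nidx s 0 = 0%N by [].
  have [t0 tn] := invariant_first_entry size_s lt_j (schur_invariant0 fs ss0).
  set nu := (gap s 1).-1 in gS t0 tn; rewrite ss0 in t0 tn.
  have n1 : nidx s 1 = nu.+1 by rewrite nS n0 gS addn0.
  have b0 : b 0%N = s`_nu by rewrite b0E n1 subn1.
  have le_s : (2 * nu.+1 <= (size s).+1)%N.
    by have := nidx_le lt_j (leqnn _); rewrite n1 size_s; lia.
  have lt_s : (nu < size s)%N by lia.
  have D1 : D (rcons s c) nu.+1 != 0.
    by rewrite hankel_rcons // -n1; apply: hankel_nidx.
  have q1 : q 1%N = (b 0%N)%:P.
    rewrite /q n1 Qpol_first //; first by rewrite nth_rcons lt_s b0.
    by move=> i lt_i; rewrite nth_rcons (ltn_trans lt_i lt_s) t0.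
  exists ((b 0%N)^-1 *: (p 1%N - (x 1%N)%:P)).
  rewrite /det_odd !det_mx2 !big_ord_recr !big_ord0 /= mul1r x0 p0 q0 q1.
  rewrite invr1 !scale1r !mulr1 !mul1r !addr0; split=> //.
  - by rewrite coefZ coefB coefC /= -horner_coef0 subrr mulr0.
  - apply/leq_sizeP => i; rewrite n1 leq_eqVlt => /predU1P[<-|lt_i].
      rewrite coefB coefZ coefB coefC coefXM /= subr0 /p n1 coef_Ppol_top //.
      rewrite mulr1 /mpar gS /= ss0 b0; apply/eqP; rewrite subr_eq0; apply/eqP.
      by rewrite -[RHS](mulfK tn) schur_m_top // mul1r.
    apply: nth_default; apply: leq_trans lt_i.
    rewrite (leq_trans (size_polyD _ _)) // geq_max size_polyN.
    apply/andP; split.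
      apply: leq_trans (size_scale_leq _ _) _.
      rewrite (leq_trans (size_polyD _ _)) // geq_max size_polyN; apply/andP.
      split; first by rewrite -n1; apply: size_Ppol_le.
      by apply: leq_trans (size_polyC_leq1 _) _.
    by rewrite -gS; apply: size_Xmpar.
  - by rewrite mul0r subr0 mulr0 add0r -mul_polyC -polyCM mulVf // b0.
have [b_neq0 [a [mon_a size_a rec_p rec_q]]] := three j.+1 lt_j.
have rec_x : b j.+1 * x j - a.[0] * x j.+1 + x j.+2 = 0.
  have := congr1 (fun f : {poly R} => f.[0]) rec_p.
  by rewrite !hornerD hornerN hornerZ hornerM horner0.
exists (((x j.+1) ^+ 2 / \prod_(k < j.+2) b k) *: (a - a.[0]%:P)); split.
- by rewrite coefZ coefB coefC /= -horner_coef0 subrr mulr0.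
- have nS := nidxS lt_j; have lt_n := nidx_lt (ltn0Sn j) (ltnW lt_j).
  have le_g : ((gap s j.+2).+1 <= nidx s j.+2)%N by rewrite nS; lia.
  rewrite (leq_trans (size_polyD _ _)) // geq_max size_polyN; apply/andP; split.
    apply: leq_trans (size_scale_leq _ _) _.
    rewrite (leq_trans (size_polyD _ _)) // geq_max size_polyN size_a.
    rewrite -/(gap s j.+2) le_g /=; apply: leq_trans (size_polyC_leq1 _) _.
    by rewrite nS; lia.
  exact: leq_trans (size_Xmpar _ lt_j) le_g.
- exact: det_odd_step.
- exact: det_odd_step.
Qed.

(** By induction on j the odd polynomial of (D) equals A_(2j-1); this is what
    makes the difference of the two odd recurrences a multiple of A_(2j), to
    which [multiple_orthogonal_eq0] applies. *)
Lemma determinants_recurrence (R : realType) (s : seq R)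
    (ss fs : nat -> seq R) (c : R) (b : nat -> R)
    (Po Pe Qo Qe : nat -> {poly R}) :
  ends_at_normal_index s -> schur_sequences s ss fs -> three_term s c b ->
  let p j := Ppol (rcons s c) (nidx s j) in
  let q j := Qpol (rcons s c) (nidx s j) in
  let x j := (p j).[0] in
  let N := size (normal_indices s) in
  Po 0%N = 0 -> Qo 0%N = 1 ->
  (forall j, (j < N)%N ->
     Po j.+1 = - det_odd b x p j.+1 /\ Qo j.+1 = det_odd b x q j.+1) ->
  (forall j, (j < N)%N ->
     Pe j = (x j)^-1 *: p j /\ Qe j = - ((x j)^-1 *: q j)) ->
  (forall j, (j < N)%N ->
     Po j.+1 = - 'X * mpar s ss j.+1 * Pe j + Po j /\
     Qo j.+1 = - 'X * mpar s ss j.+1 * Qe j + Qo j) /\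
  (forall j, (j.+1 < N)%N ->
     Pe j.+1 = lpar s ss j.+1 *: Po j.+1 + Pe j /\
     Qe j.+1 = lpar s ss j.+1 *: Qo j.+1 + Qe j).
Proof.
move=> size_s sch three p q x N Po0 Qo0 odd_det even_det.
have states := schur_invariants size_s sch; have [ss0 _] := sch.
pose A := denominators (mpar s ss) (lpar s ss).
have evenA j : (j < N)%N -> x j != 0 /\ (A j).2 = (x j)^-1 *: p j.
  by move=> lt_j; apply: even_denominator size_s lt_j (states j lt_j).
have oddA j : (j <= N)%N -> Po j = (A j).1 /\ (forall i, i.+1 = j ->
    Po i.+1 = - 'X * mpar s ss i.+1 * Pe i + Po i /\
    Qo i.+1 = - 'X * mpar s ss i.+1 * Qe i + Qo i).
  elim: j => [|j IH] lt_j; first by rewrite Po0.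
  have [PoA _] := IH (ltnW lt_j); have [xj eA] := evenA j lt_j.
  have [Y [Y0 size_Y det_p det_q]] :=
    @determinant_quotient _ _ _ fs _ _ size_s ss0 three j lt_j xj.
  have [PoS QoS] := odd_det j lt_j; have [PeE QeE] := even_det j lt_j.
  have recP : Po j.+1 = - Y * Pe j + Po j.
    rewrite PoS PeE det_p opprD mulNr; congr (_ + _).
    case: (j) lt_j => [|i] lt_i /=; rewrite ?oppr0 ?Po0 //.
    by rewrite (odd_det i (ltnW lt_i)).1.
  have recQ : Qo j.+1 = - Y * Qe j + Qo j.
    rewrite QoS QeE det_q mulrNN; congr (_ + _).
    case: (j) lt_j => [|i] lt_i /=; rewrite ?Qo0 //.
    by rewrite (odd_det i (ltnW lt_i)).2.
  have [_ oA hA] := orthogonal_even_denominator size_s lt_j (states j lt_j).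
  have n_gt0 : (0 < nidx s j.+1)%N by apply: (nidx_lt (ltn0Sn j) lt_j).
  have le_n : (2 * nidx s j.+1 - 1 <= size s)%N.
    by have := nidx_le lt_j (leqnn N); rewrite size_s -/N; lia.
  have oP : orthogonal s (Po j.+1) (nidx s j.+1).-1.
    have -> : Po j.+1 = - ((\prod_(k < j.+1) b k)^-1 * x j) *: p j.+1 +
        ((\prod_(k < j.+1) b k)^-1 * x j.+1) *: p j.
      by rewrite PoS /det_odd det_mx2 /= -!mul_polyC polyCN !polyCM; ring.
    apply: orthogonal_lincomb.
      by apply: orthogonal_Ppol_rcons; lia.
    have -> : p j = x j *: (A j).2 + 0 *: 0.
      by rewrite scaler0 addr0 eA scalerA divff // scale1r.
    by apply: orthogonal_lincomb => // k _; rewrite mul0r linear0.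
  (* Both A_(2j+1) and the determinantal polynomial are orthogonal up to the
     same power, and they differ by (Y - z m_(j+1)) A_(2j). *)
  have YE : Y = 'X * mpar s ss j.+1.
    apply/eqP; rewrite -subr_eq0; apply/eqP.
    apply: (multiple_orthogonal_eq0 oA hA); last by rewrite prednK.
      have -> : (Y - 'X * mpar s ss j.+1) * (A j).2 =
          1 *: (A j.+1).1 + (-1) *: Po j.+1.
        by rewrite recP PeE -eA PoA scale1r scaleN1r /=; ring.
      apply: orthogonal_lincomb oP.
      exact: orthogonal_odd_denominator size_s lt_j (states j lt_j).
    by rewrite coefB Y0 coefXM subr0.
  split; first by rewrite recP PeE -eA PoA YE /=; ring.
  by move=> i [->]; rewrite mulNr -YE.
split=> j lt_j; first exact: (oddA j.+1 lt_j).2 j erefl.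
have [PoS QoS] := odd_det j (ltnW lt_j).
have [PeE QeE] := even_det j (ltnW lt_j).
have [PeS QeS] := even_det j.+1 lt_j.
have [xj eA] := evenA j (ltnW lt_j); have [xS eS] := evenA j.+1 lt_j.
have recP : Pe j.+1 = lpar s ss j.+1 *: Po j.+1 + Pe j.
  by rewrite PeS PeE -eA -eS (oddA j.+1 (ltnW lt_j)).1 addrC.
split=> //.
(* The determinant K p is a nonzero polynomial, so the scalar in front of it
   in the even recurrence for P is determined; K q then has the same one. *)
pose K (f : nat -> {poly R}) := f j.+1 * (x j)%:P - f j * (x j.+1)%:P.
have KE f : (x j.+1)^-1 *: f j.+1 - (x j)^-1 *: f j =
    (x j.+1 * x j)^-1 *: K f.
  rewrite /K invfM scalerBr ![_ * _%:P]mulrC !mul_polyC !scalerA.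
  by rewrite mulrVK ?unitfE // mulrAC mulVf // mul1r.
have detE f : det_odd b x f j.+1 = (\prod_(k < j.+1) b k)^-1 *: K f.
  by rewrite /det_odd det_mx2 /K.
have Kp : K p != 0.
  have lt_n := nidx_lt (ltnSn j) (ltnW lt_j).
  have le_s : (2 * nidx s j.+1 <= (size s).+1)%N.
    by have := nidx_le (ltnW lt_j) (leqnn N); rewrite size_s -/N; lia.
  have top : (K p)`_(nidx s j.+1) = x j.
    rewrite /K coefB !coefMC coef_Ppol_top; last first.
      by rewrite hankel_rcons //; apply: hankel_nidx; apply: ltnW.
    rewrite [(p j)`__]nth_default ?mul0r ?subr0 ?mul1r //.
    exact: leq_trans (size_Ppol_le _ _) lt_n.
  by apply: contraNneq xj => K0; rewrite -top K0 coef0.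
have lE : lpar s ss j.+1 * (\prod_(k < j.+1) b k)^-1 = - (x j.+1 * x j)^-1.
  apply/eqP; rewrite -addr_eq0; apply: contraNT Kp => neq0.
  rewrite -(inj_eq (scalerI neq0)) scaler0 scalerDl -KE -PeS -PeE recP PoS.
  by rewrite scalerN detE scalerA addrK subrr.
rewrite QoS detE scalerA lE scaleNr -KE QeS QeE.
by rewrite opprB addrAC subrr add0r.
Qed.

Lemma double_succ_sub2 (j : nat) : 2 * j.+1%:Z - 2 = 2 * j%:Z.
Proof. lia. Qed.

Lemma double_succ_sub3 (j : nat) : 2 * j.+1%:Z - 3 = 2 * j%:Z - 1.
Proof. lia. Qed.

Theorem lemma5p6 (R : realType) (N : nat) (s : seq R)
    (ss fs : nat -> seq R) (P Q : int -> {poly R}) :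
  (0 < N)%N ->
  size (normal_indices s) = N ->
  size s = (2 * nidx s N - 1)%N ->
  regular s ->
  schur_sequences s ss fs ->
  plus_by_recurrence N (mpar s ss) (lpar s ss) P Q \/
  (exists (c : R) (b : nat -> R),
     three_term s c b /\ plus_by_determinants N s c b P Q) ->
  forall j : nat, (1 <= j <= N)%N ->
    Wodd (mpar s ss) (lpar s ss) j =
    mx2 (Q (2 * j%:Z - 1)) (Q (2 * j%:Z - 2))
        (P (2 * j%:Z - 1)) (P (2 * j%:Z - 2)).
Proof.
move=> _ NE size_s _ sch PQ [//|j] /andP[_ lt_j]; rewrite double_succ_sub2.
pose Po i := P (2 * i%:Z - 1); pose Pe i := P (2 * i%:Z).
pose Qo i := Q (2 * i%:Z - 1); pose Qe i := Q (2 * i%:Z).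
have init : plus_init P Q.
  by case: PQ => [[]|[c [b [_ []]]]].
have [P1 P0 Q1 Q0] := init.
have [odd_rec even_rec] :
  (forall i, (i < N)%N ->
     Po i.+1 = - 'X * mpar s ss i.+1 * Pe i + Po i /\
     Qo i.+1 = - 'X * mpar s ss i.+1 * Qe i + Qo i) /\
  (forall i, (i.+1 < N)%N ->
     Pe i.+1 = lpar s ss i.+1 *: Po i.+1 + Pe i /\
     Qe i.+1 = lpar s ss i.+1 *: Qo i.+1 + Qe i).
  case: PQ => [[_ odd_rec even_rec]|[c [b [three [_ odd_det even_det]]]]].
    split=> i lt_i.
      by have := odd_rec i.+1 lt_i; rewrite double_succ_sub2 double_succ_sub3.
    by have := even_rec i.+1; rewrite double_succ_sub2; apply; lia.
  rewrite -NE in size_s lt_j odd_det even_det *.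
  apply: (determinants_recurrence size_s sch three) => // i lt_i.
    have [PE QE] := odd_det i.+1 lt_i; rewrite /Po /Qo PE QE /det_odd.
    by rewrite -scaleNr div1r mulN1r.
  case: i lt_i => [|i] lt_i; last by apply: even_det; lia.
  rewrite /Pe /Qe mulr0 P0 Q0 /nidx /= Ppol0 Qpol0 hornerC invr1 !scale1r.
  by rewrite oppr0.
by apply: (Wodd_recurrence _ odd_rec even_rec lt_j).
Qed.
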